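(* Let $\mathcal{A}=\mathcal{A}_n^{\bar q,\Lambda}(\mathbb{K})$ and assume no $q_i$ is a root of unity. Then $\mathcal{A}$ is universally cancellative; consequently it is strongly cancellative and cancellative.
   Context: Let $\mathbb{K}$ be a field, $n\ge 1$, $\bar q=(q_1,\dots,q_n)\in(\mathbb{K}^* )^n$, and $\Lambda=(\lambda_{ij})$ an $n\times n$ matrix over $\mathbb{K}^*$ with $\lambda_{ij}=\lambda_{ji}^{-1}$, $\lambda_{ii}=1$. $\mathcal{A}_n^{\bar q,\Lambda}(\mathbb{K})$ is the $\mathbb{K}$-algebra generated by $x_1,y_1,\dots,x_n,y_n$ with relations: for $1\le i<j\le n$, $x_ix_j=\lambda_{ij}x_jx_i$, $y_jy_i=\lambda_{ji}y_iy_j$, $x_iy_j=\lambda_{ji}y_jx_i$, $x_jy_i=\lambda_{ij}y_ix_j$; and $x_iy_i-q_iy_ix_i=1$ for all $i$. A $\mathbb{K}$-algebra $A$ is cancellative if $A[t]\cong B[t]$ for a $\mathbb{K}$-algebra $B$ implies $A\cong B$; strongly cancellative if for every $d\ge1$, $A[t_1,\dots,t_d]\cong B[t_1,\dots,t_d]$ implies $A\cong B$; universally cancellative if for every finitely generated commutative $\mathbb{K}$-algebra $R$ that is a domain with $R/I\cong\mathbb{K}$ for some ideal $I$, and every $\mathbb{K}$-algebra $B$, $A\otimes_{\mathbb{K}} R\cong B\otimes_{\mathbb{K}} R$ implies $A\cong B$. *)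

(* Defs.v *)
From HB Require Import structures.
From mathcomp Require Import all_boot all_order all_algebra.
Set Implicit Arguments. Unset Strict Implicit. Unset Printing Implicit Defensive.
Import GRing.Theory.
Local Open Scope ring_scope.

Section Defs.
Variable K : fieldType.

Definition alg_iso (A B : algType K) : Prop :=
  exists f : {lrmorphism A -> B}, bijective f.

Definition qweyl_rels (n : nat) (q : 'I_n -> K) (L : 'M[K]_n)
    (C : algType K) (X Y : 'I_n -> C) : Prop :=
  (forall i j : 'I_n, (i < j)%N ->
      [/\ X i * X j = L i j *: (X j * X i),
          Y j * Y i = L j i *: (Y i * Y j),
          X i * Y j = L j i *: (Y j * X i) &
          X j * Y i = L i j *: (Y i * X j)]) /\
  (forall i : 'I_n, X i * Y i - q i *: (Y i * X i) = 1).

(* (A, x, y) is the K-algebra presented by generators x_i, y_i and the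
   relations above (universal property of the presentation). *)
Definition is_qweyl (n : nat) (q : 'I_n -> K) (L : 'M[K]_n)
    (A : algType K) (x y : 'I_n -> A) : Prop :=
  qweyl_rels q L x y /\
  forall (C : algType K) (X Y : 'I_n -> C), qweyl_rels q L X Y ->
    (exists h : {lrmorphism A -> C}, forall i, h (x i) = X i /\ h (y i) = Y i) /\
    (forall h1 h2 : {lrmorphism A -> C},
       (forall i, h1 (x i) = X i /\ h1 (y i) = Y i) ->
       (forall i, h2 (x i) = X i /\ h2 (y i) = Y i) -> h1 =1 h2).

(* (P, iA, t) is the polynomial algebra A[t_1,...,t_d] (universal property:
   free adjunction of d commuting central indeterminates). *)
Definition is_poly_ext (A : algType K) (d : nat) (P : algType K)
    (iA : {lrmorphism A -> P}) (t : 'I_d -> P) : Prop :=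
  (forall j k, t j * t k = t k * t j) /\
  (forall j a, t j * iA a = iA a * t j) /\
  forall (C : algType K) (f : {lrmorphism A -> C}) (c : 'I_d -> C),
    (forall j k, c j * c k = c k * c j) ->
    (forall j a, c j * f a = f a * c j) ->
    (exists h : {lrmorphism P -> C}, (forall a, h (iA a) = f a) /\
                                     (forall j, h (t j) = c j)) /\
    (forall h1 h2 : {lrmorphism P -> C},
       (forall a, h1 (iA a) = f a) -> (forall j, h1 (t j) = c j) ->
       (forall a, h2 (iA a) = f a) -> (forall j, h2 (t j) = c j) -> h1 =1 h2).

(* (T, iA, iR) is the tensor product A (x)_K R (universal property:
   coproduct of K-algebras with commuting images). *)
Definition is_tensor (A : algType K) (R : comAlgType K) (T : algType K)
    (iA : {lrmorphism A -> T}) (iR : {lrmorphism R -> T}) : Prop :=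
  (forall a r, iA a * iR r = iR r * iA a) /\
  forall (C : algType K) (f : {lrmorphism A -> C}) (g : {lrmorphism R -> C}),
    (forall a r, f a * g r = g r * f a) ->
    (exists h : {lrmorphism T -> C}, (forall a, h (iA a) = f a) /\
                                     (forall r, h (iR r) = g r)) /\
    (forall h1 h2 : {lrmorphism T -> C},
       (forall a, h1 (iA a) = f a) -> (forall r, h1 (iR r) = g r) ->
       (forall a, h2 (iA a) = f a) -> (forall r, h2 (iR r) = g r) -> h1 =1 h2).

Definition fin_gen_alg (R : comAlgType K) : Prop :=
  exists s : seq R, forall S : R -> Prop,
    S 1 -> (forall a b, S a -> S b -> S (a + b)) ->
    (forall a b, S a -> S b -> S (a * b)) ->
    (forall (k : K) a, S a -> S (k *: a)) ->
    (forall r, r \in s -> S r) -> forall r, S r.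

(* R is a domain (R is nonzero by its nzRing structure). *)
Definition is_domain (R : comAlgType K) : Prop :=
  forall a b : R, a * b = 0 -> a = 0 \/ b = 0.

Definition is_ideal (R : comAlgType K) (I : R -> Prop) : Prop :=
  I 0 /\ (forall a b, I a -> I b -> I (a + b)) /\ (forall r a, I a -> I (r * a)).

(* exists an ideal I with R/I ~= K as K-algebras, expressed via the first
   isomorphism theorem: a surjective K-algebra map R -> K with kernel I. *)
Definition has_K_quotient (R : comAlgType K) : Prop :=
  exists I : R -> Prop, is_ideal I /\
    exists phi : {lrmorphism R -> K^o},
      (forall r, I r <-> phi r = 0) /\ (forall k : K, exists r, phi r = k).

Definition cancellative (A : algType K) : Prop :=
  forall (B P Q : algType K) (iA : {lrmorphism A -> P}) (t : 'I_1 -> P)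
         (iB : {lrmorphism B -> Q}) (s : 'I_1 -> Q),
    is_poly_ext iA t -> is_poly_ext iB s -> alg_iso P Q -> alg_iso A B.

Definition strongly_cancellative (A : algType K) : Prop :=
  forall (d : nat), (1 <= d)%N ->
  forall (B P Q : algType K) (iA : {lrmorphism A -> P}) (t : 'I_d -> P)
         (iB : {lrmorphism B -> Q}) (s : 'I_d -> Q),
    is_poly_ext iA t -> is_poly_ext iB s -> alg_iso P Q -> alg_iso A B.

Definition universally_cancellative (A : algType K) : Prop :=
  forall (R : comAlgType K), fin_gen_alg R -> is_domain R -> has_K_quotient R ->
  forall (B T1 T2 : algType K) (iA : {lrmorphism A -> T1}) (iR1 : {lrmorphism R -> T1})
         (iB : {lrmorphism B -> T2}) (iR2 : {lrmorphism R -> T2}),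
    is_tensor iA iR1 -> is_tensor iB iR2 -> alg_iso T1 T2 -> alg_iso A B.

End Defs.

(* Main.v *)
Require Import Defs.
From HB Require Import structures.
From mathcomp Require Import all_boot all_order all_algebra.
From mathcomp Require Import boolp classical_sets functions.
From mathcomp Require Import mpoly ring.
Import GRing.Theory.
Local Open Scope ring_scope.
Set Implicit Arguments. Unset Strict Implicit. Unset Printing Implicit Defensive.

(** Since no [q_i] is a root of unity, the algebra acts on the span of the monomials
    [y^g] with [x_i] as twisted [q_i]-derivatives, faithfully and with the multiples of [y^0] as
    the only vectors killed by all [x_i]; a central element maps [y^0] to a multiple of itself,
    so it is a scalar.

    Any algebra [A] with center [K] is universally cancellative. If [T] is both [A (x) R] and
    [B (x) R], then the center of [T] is the copy of [R] from the first decomposition, and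
    [Z := Z(B)] is a retract of it. Were [Z] larger than [K], it would have a nonzero derivation
    at some [K]-point by Nakayama's lemma, and any [k] independent derivations of [R] at one
    point would give [k + 1] of them at another; but their number is bounded by the number
    of generators of [R]. So [Z(B) = K], the two copies of [R] in [T] coincide, and
    specializing [T] at a [K]-point of [R] identifies [A] with [B].

    Tensor products are only known by their universal property. Linear facts about them come
    from the slice maps [id (x) l : A (x) R -> A], for functionals [l] on [R], which are
    obtained from the action of [A (x) R] on the space of linear maps [R -> A]. *)

(** * Linear maps and functionals *)

Section LinearMaps.
Variables (K : fieldType) (U V : lmodType K).

Definition linear_fun_pred : {pred U -> V} := [pred f : U -> V | `[<linear f>]].

Lemma linear_fun_submod_closed : submod_closed linear_fun_pred.
Proof.
split=> [|a f g /asboolP lf /asboolP lg]; apply/asboolP => c u v.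
  by rewrite /= scaler0 addr0.
rewrite !fctE /= lf lg !scalerDr !scalerA [a * c]mulrC -!addrA; congr (_ + _).
by rewrite addrCA.
Qed.

HB.instance Definition _ :=
  GRing.isSubmodClosed.Build K (U -> V) linear_fun_pred linear_fun_submod_closed.

(** A subtype of [U -> V], so that it inherits the pointwise module structure and can itself be
    acted upon. *)
Record lin := Lin { lin_fun :> U -> V; _ : lin_fun \in linear_fun_pred }.

HB.instance Definition _ := [isSub for lin_fun].
HB.instance Definition _ := [Choice of lin by <:].
HB.instance Definition _ := [SubChoice_isSubLmodule of lin by <:].

Definition mklin (f : {linear U -> V}) : lin := 
  @Lin f (introT (asboolP _) (@linearP _ _ _ _ f)).

Lemma lin_linear (f : lin) : linear f.
Proof. by case: f => f /= /asboolP. Qed.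

HB.instance Definition _ (f : lin) :=
  GRing.isLinear.Build K U V *:%R f (@lin_linear f).

Lemma linP (f g : lin) : f =1 g -> f = g.
Proof. by move=> fg; apply: val_inj; apply: funext. Qed.

End LinearMaps.
Arguments mklin {K U V}.

Section EndAlgebra.
Variables (K : fieldType) (V : lmodType K) (v0 : V) (v0_neq0 : v0 != 0).

(* An [algType] has [1 != 0], hence the nonzero vector. *)
Definition lend of v0 != 0 := lin V V.
Local Notation E := (lend v0_neq0).

HB.instance Definition _ := GRing.Lmodule.on E.

Definition lend_mul (f g : E) : E := mklin (f \o g).
Definition lend_one : E := mklin idfun.

Lemma lend_mulA : associative lend_mul. Proof. by move=> f g h; apply: linP. Qed.
Lemma lend_mul1 : left_id lend_one lend_mul. Proof. by move=> f; apply: linP. Qed.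
Lemma lend_mulr1 : right_id lend_one lend_mul. Proof. by move=> f; apply: linP. Qed.
Lemma lend_mulDl : left_distributive lend_mul +%R.
Proof. by move=> f g h; apply: linP. Qed.
Lemma lend_mulDr : right_distributive lend_mul +%R.
Proof. by move=> f g h; apply: linP => v; rewrite /= !fctE /= linearD. Qed.
Lemma lend_one_neq0 : lend_one != 0.
Proof.
by apply: contraNneq v0_neq0 => /(congr1 (fun f : lin V V => f v0)) /= ->.
Qed.

HB.instance Definition _ := GRing.Zmodule_isNzRing.Build E
  lend_mulA lend_mul1 lend_mulr1 lend_mulDl lend_mulDr lend_one_neq0.

Lemma lend_scaleAl (k : K) (f g : E) : k *: (f * g) = (k *: f) * g.
Proof. by apply: linP. Qed.
HB.instance Definition _ := GRing.Lmodule_isLalgebra.Build K E lend_scaleAl.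
Lemma lend_scaleAr (k : K) (f g : E) : k *: (f * g) = f * (k *: g).
Proof. by apply: linP => v; rewrite /= !fctE /= linearZ. Qed.
HB.instance Definition _ := GRing.Lalgebra_isAlgebra.Build K E lend_scaleAr.

End EndAlgebra.

Definition subspace (K : fieldType) (V : lmodType K) (U : set V) : Prop :=
  U 0 /\ forall k u v, U u -> U v -> U (k *: u + v).

Section Subspaces.
Variables (K : fieldType) (V : lmodType K) (U : set V).
Hypothesis hU : subspace U.

Local Open Scope classical_set_scope.

(* A subspace maximal among those containing U and avoiding v is a complement of the line K v. *)
Lemma exists_separating_functional (v : V) : ~ U v ->
  exists l : {linear V -> K^o}, (forall u, U u -> l u = 0) /\ l v = 1.
Proof.
move=> vU.
pose good (S : set V) := [/\ U `<=` S, subspace S & ~ S v].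
(* Only nonempty sets have to be good: the union of the empty chain is empty and must still
   qualify. *)
have [|A [PA maxA]] := @Zorn_bigcup V [set S | forall u, S u -> good S].
  move=> F FP Ftot u [X FX Xu]; have [UX _ _] := FP _ FX _ Xu; split.
  - by move=> w /UX Xw; exists X.
  - split; first by exists X => //; apply: UX; apply: hU.1.
    move=> k a b [Xa Fa ha] [Xb Fb hb].
    have [s|s] := Ftot _ _ Fa Fb.
      by exists Xb => //; have [_ sX _] := FP _ Fb _ hb; apply: sX.2 => //; apply: s.
    by exists Xa => //; have [_ sX _] := FP _ Fa _ ha; apply: sX.2 => //; apply: s.
  - by move=> [Y FY Yv]; have [_ _] := FP _ FY _ Yv.
have [UA sA vA] : good A.
  have [[a aA]|nA] := pselect (exists a, A a); first exact: PA aA.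
  exfalso; apply: (maxA U); last by move=> u _; split.
  split; last by move=> UA; apply: nA; exists 0; apply: UA; apply: hU.1.
  by move=> a aA; case: nA; exists a.
(* If [w] is outside [A], maximality puts [v] in [A + K w]; solving for [w] gives its coefficient
   along [v]. *)
have ex w : exists c : K, A (w - c *: v).
  have [wA|wA] := pselect (A w); first by exists 0; rewrite scale0r subr0.
  pose S := [set x | exists a c, A a /\ x = a + c *: w].
  have Sw : S w by exists 0, 1; rewrite scale1r add0r; split => //; exact: sA.1.
  have AS : A `<=` S by move=> a aA; exists a, 0; rewrite scale0r addr0.
  have sS : subspace S.
    split; first by apply: AS; exact: sA.1.
    move=> k _ _ [a [c [aA ->]]] [b [d [bA ->]]].
    exists (k *: a + b), (k * c + d); split; first exact: sA.2.
    by rewrite scalerDr scalerA scalerDl addrACA.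
  have : S v.
    apply: contrapT => nSv; apply: (maxA S); first by split => // SA; exact/wA/SA.
    by move=> u _; split => // x /UA /AS.
  move=> [a [c [aA vE]]]; exists c^-1.
  have c0 : c != 0.
    by apply/eqP => c0; apply: vA; rewrite vE c0 scale0r addr0.
  have -> : w - c^-1 *: v = (- c^-1) *: a + 0.
    by rewrite vE scalerDr scalerA mulVf // scale1r opprD addrCA subrr addr0 scaleNr addr0.
  by apply: sA.2 => //; exact: sA.1.
have [l lP] := choice ex.
have uniq w c : A (w - c *: v) -> l w = c.
  move=> h; apply: contrapT => /eqP; rewrite -subr_eq0 => nz; apply: vA.
  suff : A ((l w - c) *: v).
    move=> /(sA.2 (l w - c)^-1) /(_ sA.1).
    by rewrite addr0 scalerA mulVf // scale1r.
  have -> : (l w - c) *: v = (-1) *: (w - l w *: v) + (w - c *: v).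
    by rewrite scaleN1r opprB addrA subrK scalerBl.
  exact: sA.2.
have ll : linear (l : V -> K^o).
  move=> k a b; apply: uniq.
  have -> : k *: a + b - (k *: (l a : K^o) + l b : K) *: v =
            k *: (a - l a *: v) + (b - l b *: v).
    by rewrite scalerBr scalerDl scalerA opprD addrACA.
  exact: sA.2.
exists (HB.pack_for {linear V -> K^o} (l : V -> K^o) (GRing.isLinear.Build _ _ _ _ _ ll)).
split=> [u /UA uA|]; apply: uniq; first by rewrite scale0r subr0.
by rewrite scale1r subrr; exact: sA.1.
Qed.
End Subspaces.

Definition mk_linear (K : fieldType) (U V : lmodType K) (f : U -> V)
    (lf : linear f) : {linear U -> V} :=
  HB.pack_for {linear U -> V} f (GRing.isLinear.Build _ _ _ _ f lf).

Definition mk_lrmorphism (K : fieldType) (A B : algType K) (f : A -> B)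
    (lf : linear f) (mf : monoid_morphism f) : {lrmorphism A -> B} :=
  HB.pack_for {lrmorphism A -> B} f (GRing.isLinear.Build _ _ _ _ f lf)
    (GRing.isMonoidMorphism.Build _ _ f mf).

(** * Subalgebras as targets of universal properties *)

Definition subalgebra (K : fieldType) (T : algType K) (S : set T) : Prop :=
  [/\ S 1, forall a b, S a -> S b -> S (a + b),
      forall a b, S a -> S b -> S (a * b) & forall (k : K) a, S a -> S (k *: a)].

Section SubAlgebra.
Variables (K : fieldType) (T : algType K) (S : set T) (hS : subalgebra S).

Definition subalg_pred of subalgebra S : {pred T} := [pred t | `[<S t>]].
Local Notation P := (subalg_pred hS).

Lemma subalg_pred_closed : subalg_closed P.
Proof.
case: (hS) => S1 SD SM SZ; split=> [|k a b|a b]; first exact/asboolP.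
- by move=> /asboolP Sa /asboolP Sb; apply/asboolP/SD => //; apply: SZ.
- by move=> /asboolP Sa /asboolP Sb; apply/asboolP/SM.
Qed.
HB.instance Definition _ := GRing.isSubalgClosed.Build K T P subalg_pred_closed.

Record subalg := Subalg { subalg_val :> T; _ : subalg_val \in P }.
HB.instance Definition _ := [isSub for subalg_val].
HB.instance Definition _ := [Choice of subalg by <:].
HB.instance Definition _ := [SubChoice_isSubAlgebra of subalg by <:].

Lemma subalg_valM (u v : subalg) : val (u * v) = val u * val v.
Proof. exact: rmorphM. Qed.
Lemma subalg_valB (u v : subalg) : val (u - v) = val u - val v.
Proof. exact: raddfB. Qed.
Lemma subalg_valZ k (u : subalg) : val (k *: u) = k *: val u.
Proof. exact: linearZ. Qed.
Lemma subalg_val_linear : linear (val : subalg -> T).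
Proof. exact: linearP. Qed.
Lemma subalg_val_monoid_morphism : monoid_morphism (val : subalg -> T).
Proof. by split; [exact: rmorph1|exact: subalg_valM]. Qed.
Definition subalg_incl : {lrmorphism subalg -> T} :=
  mk_lrmorphism subalg_val_linear subalg_val_monoid_morphism.

Lemma subalg_lift (A : algType K) (f : {lrmorphism A -> T}) :
  (forall a, S (f a)) ->
  exists g : {lrmorphism A -> subalg}, forall a, val (g a) = f a.
Proof.
move=> Sf.
pose g a : subalg := Subalg (introT (asboolP _) (Sf a) : f a \in P).
have lg : linear g by move=> k a b; apply: val_inj; rewrite /= linearP.
have mg : monoid_morphism g.
  by split=> [|a b]; apply: val_inj; rewrite /= ?rmorph1 ?rmorphM.
by exists (mk_lrmorphism lg mg).
Qed.
End SubAlgebra.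

Definition central (K : fieldType) (A : algType K) (z : A) : Prop :=
  forall a, z * a = a * z.

Definition scalar_center (K : fieldType) (A : algType K) : Prop :=
  forall z : A, central z -> exists k : K, z = k *: 1.

(** * Tensor products and their slices *)

Section TensorSpan.
Variables (K : fieldType) (A : algType K) (R : comAlgType K) (T : algType K).
Variables (iA : {lrmorphism A -> T}) (iR : {lrmorphism R -> T}).
Hypothesis hT : is_tensor iA iR.

(** The universal property maps [T] to the subalgebra; followed by the inclusion, this map fixes
    [iA] and [iR], so uniqueness makes it the identity. *)
Lemma tensor_subalg (S : set T) : subalgebra S ->
  (forall a, S (iA a)) -> (forall r, S (iR r)) -> forall t, S t.
Proof.
move=> hS /(subalg_lift hS) [f fE] /(subalg_lift hS) [g gE] t.
have fg a r : f a * g r = g r * f a.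
  by apply: val_inj; rewrite !subalg_valM fE gE hT.1.
have [[h [hf hg]] _] := hT.2 _ f g fg.
have [_ uniq] := hT.2 _ iA iR hT.1.
have E : (subalg_incl hS \o h : {lrmorphism T -> T}) =1 (idfun : {lrmorphism T -> T}).
  by apply: uniq => // [a|r] /=; rewrite ?hf ?hg ?fE ?gE.
by rewrite -[t]/(idfun t) -E /=; case: (h t) => s /= /asboolP.
Qed.

Lemma tensorC a r : iA a * iR r = iR r * iA a. Proof. exact: hT.1. Qed.

Lemma tensor_span t :
  exists s : seq (A * R), t = \sum_(p <- s) iA p.1 * iR p.2.
Proof.
apply: (@tensor_subalg (fun t => exists s : seq (A * R),
   t = \sum_(p <- s) iA p.1 * iR p.2)); last 2 first.
- by move=> a; exists [:: (a, 1)]; rewrite big_seq1 rmorph1 mulr1.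
- by move=> r; exists [:: (1, r)]; rewrite big_seq1 rmorph1 mul1r.
split.
- by exists [:: (1, 1)]; rewrite big_seq1 !rmorph1 mul1r.
- by move=> _ _ [s1 ->] [s2 ->]; exists (s1 ++ s2); rewrite big_cat.
- move=> _ _ [s1 ->] [s2 ->].
  exists [seq (p.1 * p'.1, p.2 * p'.2) | p <- s1, p' <- s2].
  rewrite big_allpairs_dep mulr_suml; apply: eq_bigr => p _ /=.
  rewrite mulr_sumr; apply: eq_bigr => p' _.
  by rewrite !rmorphM /= -!mulrA; congr (_ * _); rewrite !mulrA tensorC.
- move=> k _ [s ->]; exists [seq (k *: p.1, p.2) | p <- s].
  rewrite big_map scaler_sumr; apply: eq_bigr => p _ /=.
  by rewrite linearZ /= scalerAl.
Qed.

Lemma tensor_ind (P : T -> Prop) : P 0 -> (forall u v, P u -> P v -> P (u + v)) ->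
  (forall a r, P (iA a * iR r)) -> forall t, P t.
Proof.
by move=> P0 PD Pm t; have [s ->] := tensor_span t; apply: big_ind => // p _.
Qed.

(** On linear maps [R -> A], [A] acts by left multiplication of the values and [R] by multiplication
    of the argument. The slice lets [t] act on [s |-> l s *: 1] and evaluates at [1]. *)
Lemma exists_slice (l : {linear R -> K^o}) :
  exists f : {linear T -> A}, forall a r, f (iA a * iR r) = l r *: a.
Proof.
have lw : linear (fun s => (l s : K) *: (1 : A)).
  by move=> k u v; rewrite linearP /= scalerDl scalerA.
pose w0 : lin R A := mklin (mk_linear lw).
(* [w0] doubles as the nonzero vector that [lend] demands; if it is zero, so is every [l r *: a],
   and the zero slice works. *)
have [w00|w00] := eqVneq w0 0.
  exists (mk_linear (fun k u v => esym (etrans (addr0 _) (scaler0 A k)))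
     : {linear T -> A}) => a r /=.
  have /= : w0 r = 0 by rewrite w00.
  by move=> /(congr1 ( *%R^~ a)); rewrite mul0r -scalerAl mul1r.
pose E : algType K := lend w00.
have lA1 a (w : lin R A) : linear (fun s => a * w s).
  by move=> k u v; rewrite linearP /= mulrDr scalerAr.
have lA2 a : linear (fun w : lin R A => mklin (mk_linear (lA1 a w))).
  by move=> k u v; apply: linP => s; rewrite /= !fctE /= mulrDr scalerAr.
pose fA (a : A) : E := mklin (mk_linear (lA2 a)).
have lfA : linear fA.
  move=> k a b; apply: linP => w; apply: linP => s.
  by rewrite /= !fctE /= mulrDl scalerAl.
have mfA : monoid_morphism fA.
  by split=> [|a b]; apply: linP => w; apply: linP => s; rewrite /= ?mul1r ?mulrA.
have lR1 r (w : lin R A) : linear (fun s => w (s * r)).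
  by move=> k u v; rewrite mulrDl -scalerAl linearP.
have lR2 r : linear (fun w : lin R A => mklin (mk_linear (lR1 r w))).
  by move=> k u v; apply: linP.
pose fR (r : R) : E := mklin (mk_linear (lR2 r)).
have lfR : linear fR.
  move=> k a b; apply: linP => w; apply: linP => s.
  by rewrite /= !fctE /= mulrDr -scalerAr linearP.
have mfR : monoid_morphism fR.
  by split=> [|a b]; apply: linP => w; apply: linP => s; rewrite /= ?mulr1 ?mulrA.
have [|[h [hA hR]] _] := hT.2 E (mk_lrmorphism lfA mfA) (mk_lrmorphism lfR mfR).
  by move=> a r; apply: linP => w; apply: linP.
have lh : linear (fun t => (h t : lin _ _) w0 1).
  by move=> k u v; rewrite linearP.
exists (mk_linear lh) => a r /=.
by rewrite rmorphM /= hA hR /= mul1r -scalerAr mulr1.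
Qed.

Definition slice l : {linear T -> A} := projT1 (cid (exists_slice l)).
Lemma sliceE l a r : slice l (iA a * iR r) = l r *: a.
Proof. exact: (projT2 (cid (exists_slice l))). Qed.

Lemma slice_iA l a : slice l (iA a) = l 1 *: a.
Proof. by rewrite -sliceE rmorph1 mulr1. Qed.
Lemma slice_iR l r : slice l (iR r) = l r *: 1.
Proof. by rewrite -sliceE rmorph1 mul1r. Qed.

(** The two-term shape covers point derivations as well as characters, whose second term is zero. *)
Lemma slice_mul (l l1 l2 l3 l4 : {linear R -> K^o}) :
  (forall r s : R, l (r * s) = (l1 r : K) * l2 s + (l3 r : K) * l4 s) ->
  forall t u : T, slice l (t * u) = slice l1 t * slice l2 u + slice l3 t * slice l4 u.
Proof.
move=> lE t u; elim/tensor_ind: t => [|t t' IH IH'|a r].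
- by rewrite mul0r !linear0 !mul0r addr0.
- by rewrite mulrDl !linearD /= IH IH' !mulrDl addrACA.
elim/tensor_ind: u => [|u u' IH IH'|b s].
- by rewrite mulr0 !linear0 !mulr0 addr0.
- by rewrite mulrDr !linearD /= IH IH' !mulrDr addrACA.
have -> : iA a * iR r * (iA b * iR s) = iA (a * b) * iR (r * s).
  by rewrite !rmorphM /= -!mulrA; congr (_ * _); rewrite !mulrA tensorC.
by rewrite !sliceE lE scalerDl -!scalerAl -!scalerAr !scalerA.
Qed.

Lemma slice_mulAl l a t : slice l (iA a * t) = a * slice l t.
Proof.
elim/tensor_ind: t => [|t t' IH IH'|b r]; first by rewrite mulr0 linear0 mulr0.
  by rewrite mulrDr !linearD /= IH IH' mulrDr.
by rewrite mulrA -rmorphM !sliceE scalerAr.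
Qed.
Lemma slice_mulAr l a t : slice l (t * iA a) = slice l t * a.
Proof.
elim/tensor_ind: t => [|t t' IH IH'|b r]; first by rewrite mul0r linear0 mul0r.
  by rewrite mulrDl !linearD /= IH IH' mulrDl.
by rewrite -mulrA -tensorC mulrA -rmorphM !sliceE scalerAl.
Qed.

Lemma slice_central l t : central t -> central (slice l t).
Proof. by move=> ct a; rewrite -slice_mulAl -slice_mulAr ct. Qed.

Lemma iR_central r : central (iR r).
Proof.
move=> t; elim/tensor_ind: t => [|t t' IH IH'|a s]; first by rewrite mul0r mulr0.
  by rewrite mulrDl mulrDr IH IH'.
by rewrite mulrA -tensorC -!mulrA -!rmorphM /= mulrC.
Qed.

Lemma iA_central a : central a -> central (iA a).
Proof.
move=> ca t; elim/tensor_ind: t => [|t t' IH IH'|b s]; first by rewrite mul0r mulr0.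
  by rewrite mulrDl mulrDr IH IH'.
by rewrite mulrA -rmorphM ca rmorphM -!mulrA tensorC.
Qed.

(** A functional with [l r = 1] would slice [iR r = 0] to [1]. *)
Lemma iR_inj : injective iR.
Proof.
suff inj0 r : iR r = 0 -> r = 0.
  by move=> r s /eqP; rewrite -subr_eq0 -rmorphB => /eqP/inj0/eqP; rewrite subr_eq0 => /eqP.
move=> r0; apply: contrapT => rn0.
have [||l [_ l1]] := @exists_separating_functional K R [set r | r = 0]%classic _ r.
- by split=> // k u v /= -> ->; rewrite scaler0 addr0.
- by [].
have := slice_iR l r; rewrite r0 linear0 l1 scale1r => /eqP.
by rewrite eq_sym oner_eq0.
Qed.

(** Induction on the number of terms. If the first [r] depends linearly on the others, its term is
    absorbed by them; otherwise a functional isolating it shows that its [a] is a scalar, so that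
    this term lies in the image of [iR]. *)
Lemma scalar_slices_sum m (a : 'I_m -> A) (r : 'I_m -> R) :
  (forall l : {linear R -> K^o}, exists k, \sum_i l (r i) *: a i = k *: (1 : A)) ->
  exists r0, \sum_i iA (a i) * iR (r i) = iR r0.
Proof.
elim: m a r => [|m IH] a r sl; first by exists 0; rewrite big_ord0 rmorph0.
pose r' i := r (lift ord0 i).
pose U : set R := fun x => exists c : 'I_m -> K, x = \sum_i c i *: r' i.
have sU : subspace U.
  split; first by exists (fun=> 0); rewrite big1 // => i _; rewrite scale0r.
  move=> k _ _ [c ->] [d ->]; exists (fun i => k * c i + d i).
  rewrite scaler_sumr -big_split; apply: eq_bigr => i _ /=.
  by rewrite scalerDl scalerA.
have r'U i : U (r' i).
  exists (fun j => (j == i)%:R); rewrite (bigD1 i) //= eqxx scale1r big1 ?addr0 //.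
  by move=> j /negPf ->; rewrite scale0r.
have [[c rE]|nU] := pselect (U (r ord0)).
  have [|r0 r0E] := IH (fun i => a (lift ord0 i) + c i *: a ord0) r'.
    move=> l; have [k kE] := sl l; exists k; rewrite -kE big_ord_recl rE linear_sum /=.
    rewrite scaler_suml -big_split; apply: eq_bigr => i _ /=.
    by rewrite linearZ scalerDr scalerA [_ * c i]mulrC addrC.
  exists r0; rewrite -r0E big_ord_recl rE rmorph_sum mulr_sumr -big_split /=.
  apply: eq_bigr => i _; rewrite rmorphD mulrDl linearZ /= addrC.
  by rewrite [iA (_ *: _)]linearZ -scalerAl -scalerAr.
have [l [lU l1]] := exists_separating_functional sU nU.
have [k kE] := sl l; move: kE.
rewrite big_ord_recl l1 scale1r big1 ?addr0 => [a0E|i _]; last first.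
  by rewrite (lU _ (r'U i)) scale0r.
(* Dropping the first term changes the slice by the scalar [l' (r ord0) * k]. *)
have [|r0 r0E] := IH (fun i => a (lift ord0 i)) r'.
  move=> l'; have [k' k'E] := sl l'; exists (k' - l' (r ord0) * k).
  by rewrite scalerBl -k'E big_ord_recl a0E scalerA addrC addKr.
exists (k *: r ord0 + r0); rewrite big_ord_recl r0E a0E rmorphD [iA _]linearZ.
by rewrite /= rmorph1 -scalerAl mul1r [RHS]addrC linearZ addrC.
Qed.

Lemma tensor_center : scalar_center A ->
  forall t, central t -> exists r, t = iR r.
Proof.
move=> sA t /slice_central ct; have [s] := tensor_span t.
rewrite big_tnth => tE; rewrite tE; apply: scalar_slices_sum => l.
have [k kE] := sA _ (ct l); exists k; rewrite -kE tE linear_sum.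
by apply: eq_bigr => i _; rewrite sliceE.
Qed.
End TensorSpan.

(** * Point derivations of finitely generated domains *)

Section PointDerivations.
Variables (K : fieldType) (R : comAlgType K) (s : seq R).
Hypothesis gen_s : forall S : R -> Prop,
    S 1 -> (forall a b, S a -> S b -> S (a + b)) ->
    (forall a b, S a -> S b -> S (a * b)) ->
    (forall (k : K) a, S a -> S (k *: a)) ->
    (forall r, r \in s -> S r) -> forall r, S r.
Hypothesis dom_R : is_domain R.

Definition point_derivation (e : R -> K^o) (d : R -> K^o) : Prop :=
  forall r r', d (r * r') = (e r : K) * d r' + (d r : K) * e r'.

(** The Zariski tangent space at some [K]-point has dimension at least [k]. *)
Definition independent_point_derivations k : Prop :=
  exists (e : {lrmorphism R -> K^o}) (d : 'I_k -> {linear R -> K^o}),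
    (forall i, point_derivation e (d i)) /\
    (forall c : 'I_k -> K, (forall r, \sum_i c i * (d i r : K) = 0) -> forall i, c i = 0).

Lemma point_derivation1 (e : {lrmorphism R -> K^o}) (d : R -> K^o) :
  point_derivation e d -> d 1 = 0.
Proof.
move=> /(_ 1 1); rewrite !mul1r rmorph1 mul1r mulr1 => /eqP.
by rewrite -subr_eq0 opprD addrA subrr add0r oppr_eq0 => /eqP.
Qed.

(** By the Leibniz rule, a combination of the [d i] vanishing on the generators vanishes everywhere,
    so the matrix of values on the generators has independent rows. *)
Lemma independent_point_derivations_bound k :
  independent_point_derivations k -> (k <= size s)%N.
Proof.
move=> [e [d [der_d ind]]].
pose M : 'M[K]_(k, size s) := \matrix_(i, j) d i (s`_j).
suff /eqP <- : row_free M by exact: rank_leq_col.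
apply/inj_row_free => u uM.
apply/rowP => i; rewrite mxE; apply: (ind (fun i => u ord0 i)) => {i}.
apply: gen_s.
- by rewrite big1 // => i _; rewrite (point_derivation1 (der_d i)) mulr0.
- move=> a b Sa Sb; under eq_bigr do rewrite linearD mulrDr.
  by rewrite big_split /= Sa Sb addr0.
- move=> a b Sa Sb; under eq_bigr do rewrite der_d mulrDr mulrCA [_ * (_ * e b)]mulrA.
  by rewrite big_split /= -mulr_sumr -mulr_suml Sa Sb mulr0 mul0r addr0.
- move=> c a Sa; under eq_bigr do rewrite linearZ /= mulrCA.
  by rewrite -mulr_sumr Sa mulr0.
move=> r /(nthP 0) [j lt_j <-].
have := congr1 (fun v : 'rV[K]__ => v ord0 (Ordinal lt_j)) uM.
rewrite !mxE => E; apply: etrans E.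
by apply: eq_bigr => i _; rewrite mxE.
Qed.

Section Retract.
Variables (e : {lrmorphism R -> K^o}) (D : set R) (p : {lrmorphism R -> R}).
Hypotheses (Dp : forall r, D (p r)) (pD : forall c, D c -> p c = c).

(* The ideal of [D] at [e] is generated by the [m j]; Nakayama's lemma says that it vanishes if
   it equals its square. *)
Let m (j : 'I_(size s)) : R := p s`_j - e (p s`_j) *: 1.

Let em j : e (m j) = 0.
Proof. by rewrite linearB linearZ /= rmorph1 /GRing.scale /= mulr1 subrr. Qed.

(** In a product, the expansion of [p a] is multiplied by [p b], and only its constant term needs
    the expansion of [p b]. *)
Let ideal_gen r : exists (k : K) (c : 'I_(size s) -> R),
  p r = k *: 1 + \sum_j p (c j) * m j.
Proof.
elim/gen_s: r => [|a b [ka [ca pa]] [kb [cb pb]]|a b [ka [ca pa]] [kb [cb pb]]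
                 |k a [ka [ca pa]]|r /(nthP 0) [j lt_j <-]].
- exists 1, (fun=> 0); rewrite big1 ?addr0 => [|j _]; last by rewrite rmorph0 mul0r.
  by rewrite rmorph1 scale1r.
- exists (ka + kb), (fun j => ca j + cb j); rewrite rmorphD /= pa pb.
  rewrite scalerDl addrACA -big_split /=; congr (_ + _).
  by apply: eq_bigr => j _; rewrite rmorphD mulrDl.
- exists (ka * kb), (fun j => ca j * b + ka *: cb j).
  rewrite rmorphM /= {1}pa mulrDl -scalerAl mul1r {1}pb scalerDr scalerA -addrA.
  congr (_ + _); rewrite scaler_sumr mulr_suml -big_split /=.
  apply: eq_bigr => j _; rewrite rmorphD rmorphM /= linearZ /= mulrDl addrC.
  by rewrite mulrAC -scalerAl.
- exists (k * ka), (fun j => k *: ca j); rewrite linearZ /= pa scalerDr scalerA.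
  congr (_ + _); rewrite scaler_sumr; apply: eq_bigr => j _.
  by rewrite linearZ /= scalerAl.
exists (e (p s`_j)), (fun i => (i == Ordinal lt_j)%:R).
rewrite (bigD1 (Ordinal lt_j)) //= eqxx rmorph1 mul1r big1 => [|i /negPf ->].
  by rewrite /m addr0 addrC subrK.
by rewrite rmorph0 mul0r.
Qed.

Let e_ideal (c : 'I_(size s) -> R) (k : K) :
  e (k *: 1 + \sum_j p (c j) * m j) = k.
Proof.
rewrite linearD linearZ /= rmorph1 /GRing.scale /= mulr1 linear_sum big1 ?addr0 //.
by move=> j _; rewrite rmorphM /= em mulr0.
Qed.

(* [U] is [K + I^2], where [I] is the ideal of [D] at [e]. *)
Let U : set R := fun x => exists (k : K) (a : 'I_(size s) -> R),
  (forall j, e (p (a j)) = 0) /\ x = k *: 1 + \sum_j p (a j) * m j.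

Let sU : subspace U.
Proof.
split.
  exists 0, (fun=> 0); split=> [j|]; first by rewrite !rmorph0.
  by rewrite scale0r add0r big1 // => j _; rewrite rmorph0 mul0r.
move=> k _ _ [ka [ca [ea ->]]] [kb [cb [eb ->]]].
exists (k * ka + kb), (fun j => k *: ca j + cb j); split=> [j|].
  by rewrite !linearP /= ea eb scaler0 addr0.
rewrite scalerDr scalerA addrACA -scalerDl scaler_sumr -big_split /=.
by congr (_ + _); apply: eq_bigr => j _; rewrite linearP /= mulrDl scalerAl.
Qed.

Let U_one : U 1.
Proof.
exists 1, (fun=> 0); split=> [j|]; first by rewrite !rmorph0.
by rewrite scale1r big1 ?addr0 // => j _; rewrite rmorph0 mul0r.
Qed.

Let U_mul c c' : D c -> D c' -> e c = 0 -> e c' = 0 -> U (c * c').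
Proof.
move=> Dc Dc' ec ec'; have [k [a ca]] := ideal_gen c'; move: ca; rewrite (pD Dc').
move=> c'E; have := e_ideal a k; rewrite -c'E ec' => k0.
(* [c] is absorbed into the coefficients of [c'], which therefore vanish at [e]. *)
exists 0, (fun j => c * a j); split=> [j|].
  by rewrite !rmorphM /= (pD Dc) ec mul0r.
rewrite c'E -k0 !scale0r !add0r mulr_sumr; apply: eq_bigr => j _.
by rewrite rmorphM /= (pD Dc) mulrA.
Qed.

(** The determinant trick: the relations read [M *m v = 0], the adjugate turns this into
    [\det M * m j = 0], and [\det M] is nonzero because [M] becomes the identity at [e]. *)
Let nakayama : (forall j, U (m j)) -> forall j, m j = 0.
Proof.
move=> mU.
have {mU} : forall j, exists a : 'I_(size s) -> R, (forall i, e (p (a i)) = 0) /\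
    m j = \sum_i p (a i) * m i.
  move=> j; have [k [a [ea mE]]] := mU j; exists a; split=> //.
  by have := e_ideal a k; rewrite -mE em => k0; rewrite {1}mE -k0 scale0r add0r.
move=> /choice [a aP].
pose M : 'M[R]_(size s) := 1%:M - \matrix_(j, i) p (a j i).
pose v : 'cV[R]_(size s) := \col_j m j.
have Mv : M *m v = 0.
  rewrite mulmxBl mul1mx; apply/colP => j; rewrite !mxE {1}(aP j).2.
  by apply/eqP; rewrite subr_eq0; apply/eqP/eq_bigr => i _; rewrite !mxE.
have dM : \det M != 0.
  have : e (\det M) = 1.
    rewrite -det_map_mx; suff -> : map_mx e M = 1%:M by rewrite det1.
    apply/matrixP => i j; rewrite !mxE linearB /= (aP i).1 subr0.
    by rewrite rmorph_nat.
  by apply: contra_eq_neq => ->; rewrite rmorph0 eq_sym oner_eq0.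
move=> j; have : (\det M)%:M *m v = 0 by rewrite -mul_adj_mx -mulmxA Mv mulmx0.
move=> /colP /(_ j); rewrite mul_scalar_mx !mxE => /dom_R [d0|//].
by rewrite d0 eqxx in dM.
Qed.

(** If all [m j] were in [U], they would vanish by [nakayama] and [D] would consist of scalars. A
    functional that kills [K + I^2] satisfies the Leibniz rule on [D]. *)
Lemma exists_point_derivation c0 : D c0 -> ~ (exists k, c0 = k *: 1) ->
  exists (l : {linear R -> K^o}) (v : R), [/\ D v, l v = 1 &
    forall c c', D c -> D c' -> l (c * c') = (e c : K) * l c' + (l c : K) * e c'].
Proof.
move=> Dc0 nc0; have [j mj] : exists j, ~ U (m j).
  apply/existsNP => /nakayama m0; apply: nc0.
  have [k [a]] := ideal_gen c0; rewrite (pD Dc0) => ->; exists k.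
  by rewrite big1 ?addr0 // => i _; rewrite m0 mulr0.
have [l [lU lm]] := exists_separating_functional sU mj.
have Dsub c k : D c -> D (c - k *: 1).
  by move=> Dc; rewrite -(pD Dc) -(rmorph1 p) -linearZ -linearB /=; apply: Dp.
exists l, (m j); split=> [||c c' Dc Dc']; [exact: Dsub|by []|].
have esub x : e (x - (e x : K) *: 1) = 0.
  by rewrite linearB linearZ /= rmorph1 /GRing.scale /= mulr1 subrr.
(* The product of [c - e c] and [c' - e c'] lies in [I^2]; expanding it under [l] gives the Leibniz
   rule. *)
have /lU := U_mul (Dsub c (e c) Dc) (Dsub c' (e c') Dc') (esub c) (esub c').
have -> : (c - (e c : K) *: 1) * (c' - (e c' : K) *: 1) =
    c * c' - ((e c : K) *: c' + (e c' : K) *: c) + ((e c : K) * e c') *: 1.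
  rewrite mulrBl !mulrBr -!scalerAl -!scalerAr !mul1r mulr1 scalerA.
  by rewrite !opprD opprK !addrA; congr (_ + _); rewrite addrAC.
rewrite linearD linearB /= linearD /= linearZ /= linearZ /= linearZ /= (lU _ U_one).
rewrite scaler0 addr0 => /eqP; rewrite subr_eq0 => /eqP ->.
by rewrite /GRing.scale /= [_ * l c]mulrC.
Qed.
End Retract.

(* A nontrivial retract of [R] would make the maximal number of independent point derivations
   unbounded: composing with it gives one more of them at another point. *)
Lemma retract_scalar (e0 : {lrmorphism R -> K^o}) (D : set R) (f : R -> R) :
  (forall e : {lrmorphism R -> K^o}, exists p : {lrmorphism R -> R},
    [/\ forall r, D (p r), forall c, D c -> p c = c &
      forall d : {linear R -> K^o}, point_derivation e d ->
      exists S : {linear R -> R},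
        [/\ forall r r', S (r * r') = p r * S r' + S r * p r',
            forall r, S (f r) = d r *: 1 & forall c, D c -> S c = 0]]) ->
  forall c, D c -> exists k, c = k *: 1.
Proof.
move=> H c Dc; apply: contrapT => nc.
suff step k : independent_point_derivations k -> independent_point_derivations k.+1.
  have all k : independent_point_derivations k.
    elim: k => [|k IH]; last exact: step.
    by exists e0, (fun i => mk_linear (fun k u v => linearP e0 k u v)); split=> [[]|? ? []].
  by have := independent_point_derivations_bound (all (size s).+1); rewrite ltnn.
move=> [e [d [der_d ind]]].
have [p [Dp pD Hd]] := H e.
(* The extra derivation is taken at [e0], although [p] comes from [e]. *)
have [l [v [Dv lv lmul]]] := exists_point_derivation e0 Dp pD Dc nc.
have /choice [S SP] := fun i => Hd (d i) (der_d i).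
(* At the new point [e0 \o p], the family consists of [l \o p] and the maps [e0 \o S i]. *)
exists (e0 \o p : {lrmorphism R -> K^o}).
pose d' (o : option 'I_k) : {linear R -> K^o} :=
  if o is Some i then (e0 \o S i : {linear R -> K^o}) else (l \o p : {linear R -> K^o}).
exists (fun i => d' (unlift ord0 i)); split=> [i r r'|a a0].
  case: (unlift ord0 i) => [j|] /=; last by rewrite rmorphM /= lmul.
  by have [-> _ _] := SP j; rewrite rmorphD !rmorphM.
have {}a0 r : a ord0 * l (p r) + \sum_i a (lift ord0 i) * e0 (S i r) = 0.
  apply: etrans (a0 r); rewrite big_ord_recl unlift_none /=; congr (_ + _).
  by apply: eq_bigr => i _; rewrite liftK.
(* Since [v] lies in [D], all [S i] vanish there while [l (p v) = 1]. Evaluation at [f r] then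
   leaves a relation among the [d i]. *)
have a00 : a ord0 = 0.
  have := a0 v; rewrite (pD _ Dv) lv mulr1 big1 ?addr0 // => i _.
  by have [_ _ ->] := SP i; rewrite ?rmorph0 ?mulr0.
have aS i : a (lift ord0 i) = 0.
  apply: (ind (fun i => a (lift ord0 i))) => r.
  have := a0 (f r); rewrite a00 mul0r add0r => E; apply: etrans E.
  apply: eq_bigr => j _; have [_ -> _] := SP j.
  by rewrite linearZ /= rmorph1 /GRing.scale /= mulr1.
by move=> i; have [j ->|->] := unliftP ord0 i; rewrite ?a00 ?aS.
Qed.
End PointDerivations.

(** * Cancellation for algebras with scalar center *)

Section Cancellation.
Variables (K : fieldType).

Lemma tensor_iso (A : algType K) (R : comAlgType K) (T1 T2 : algType K)
    (iA : {lrmorphism A -> T1}) (iR : {lrmorphism R -> T1})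
    (f : {lrmorphism T1 -> T2}) : bijective f -> is_tensor iA iR ->
  is_tensor (f \o iA : {lrmorphism A -> T2}) (f \o iR : {lrmorphism R -> T2}).
Proof.
move=> [g fK gK] [comm univ]; split=> [a r|C u v uv].
  by rewrite /= -!rmorphM comm.
have [[h [hA hR]] uniq] := univ C u v uv; split.
  pose g' : {lrmorphism T2 -> T1} :=
    mk_lrmorphism (can2_linear fK gK) (can2_monoid_morphism fK gK).
  exists (h \o g' : {lrmorphism T2 -> C}).
  by split=> [a|r]; rewrite /= fK ?hA ?hR.
move=> h1 h2 h1A h1R h2A h2R t.
by rewrite -(gK t); apply: (uniq (h1 \o f) (h2 \o f)).
Qed.

Section TwoFactorizations.
Variables (A B : algType K) (R : comAlgType K) (T : algType K).
Variables (iA : {lrmorphism A -> T}) (iR1 : {lrmorphism R -> T}).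
Variables (iB : {lrmorphism B -> T}) (iR2 : {lrmorphism R -> T}).
Hypotheses (hA : is_tensor iA iR1) (hB : is_tensor iB iR2).
Hypotheses (ZA : scalar_center A) (fgR : fin_gen_alg R) (domR : is_domain R).
Variable e0 : {lrmorphism R -> K^o}.

(** [retract_scalar] is applied to the copy [D] of [Z(B)] in [R]; slicing [iR1 r] along the second
    decomposition by a character gives [p], and by a point derivation gives [S]. *)
Lemma scalar_center_cofactor : scalar_center B.
Proof.
have [s gen_s] := fgR.
(* [q] inverts [iR1] on the center of [T]; elsewhere its value is arbitrary. *)
have /choice [q qP] : forall t, exists r, central t -> iR1 r = t.
  move=> t; have [ct|nct] := pselect (central t); last by exists 0.
  by have [r ->] := tensor_center hA ZA ct; exists r.
have sliceZ (l : {linear R -> K^o}) r : central (slice hB l (iR1 r)).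
  by apply: slice_central; exact: (iR_central hA).
pose P (l : {linear R -> K^o}) r := q (iB (slice hB l (iR1 r))).
have PE l r : iR1 (P l r) = iB (slice hB l (iR1 r)).
  by apply: qP; apply: (iA_central hB); exact: sliceZ.
have Plin l : linear (P l).
  move=> k u v; apply: (iR_inj hA).
  by rewrite PE [in RHS]linearP /= !PE !linearP.
pose D : set R := fun c => exists z, central z /\ iR1 c = iB z.
have core : forall c, D c -> exists k, c = k *: 1.
  apply: (@retract_scalar K R s gen_s domR e0 D (fun r => q (iR2 r))) => e.
  pose el : {linear R -> K^o} := e.
  have pmul : monoid_morphism (P el).
    split=> [|r r']; apply: (iR_inj hA).
      by rewrite PE !rmorph1 -(rmorph1 iB) (slice_iA hB) /= rmorph1 scale1r.
    rewrite (rmorphM iR1) /= !PE -(rmorphM iB) (rmorphM iR1) /=; congr (iB _).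
    have -> : slice hB el (iR1 r * iR1 r') = slice hB el (iR1 r) * slice hB el (iR1 r')
        + slice hB \0 (iR1 r) * slice hB \0 (iR1 r').
      by apply: slice_mul => a b; rewrite /= rmorphM mulr0 addr0.
    have -> : slice hB \0 (iR1 r) = 0.
      elim/(tensor_ind hB): (iR1 r) => [|u v hu hv|a a']; first by rewrite linear0.
        by rewrite linearD /= hu hv addr0.
      by rewrite sliceE scale0r.
    by rewrite mul0r addr0.
  exists (mk_lrmorphism (Plin el) pmul); split=> [r|c [z [cz cE]]|d dd].
  - by exists (slice hB el (iR1 r)); split; [exact: sliceZ|exact: PE].
  - apply: (iR_inj hA); rewrite /= PE cE (slice_iA hB).
    by rewrite -[X in X *: _]/(e 1) rmorph1 scale1r.
  (* Elements of [D] come from [B] and are killed because [d 1 = 0]; [q (iR2 r)] goes to [d r], the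
     slice of [iR2 r]. *)
  exists (mk_linear (Plin d)); split=> /= [r r'|r|c [z [cz cE]]]; apply: (iR_inj hA).
  - rewrite (rmorphD iR1) !(rmorphM iR1) /= !PE -!(rmorphM iB) -(rmorphD iB).
    by congr (iB _); rewrite (rmorphM iR1); apply: slice_mul.
  - rewrite PE qP; last by move=> u; exact: (iR_central hB).
    by rewrite (slice_iR hB) linearZ rmorph1 linearZ /= rmorph1.
  - by rewrite PE cE (slice_iA hB) (point_derivation1 dd) scale0r !rmorph0.
move=> z cz; have czT := iA_central hB cz.
have [|k qE] := core (q (iB z)); first by exists z; split=> //; exact: qP.
exists k; have := qP _ czT; rewrite qE linearZ /= rmorph1 => zE.
(* Slicing by [e0] recovers [z] from [iB z], because [e0 1 = 1]. *)
have := slice_iA hB e0 z; rewrite rmorph1 scale1r => <-.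
by rewrite -zE linearZ /= -(rmorph1 iB) (slice_iA hB) rmorph1 scale1r.
Qed.

(** Both [iR1] and [iR2] now have the center of [T] as image. Specializing the two decompositions at
    matching points gives [FA] and [FB], and [FB \o iA] is inverse to [FA \o iB]. *)
Lemma alg_iso_cofactors : alg_iso A B.
Proof.
have ZB := scalar_center_cofactor.
have /choice [k1 k1P] : forall r, exists r', iR1 r' = iR2 r.
  by move=> r; have [|r' ->] := tensor_center hA ZA (t := iR2 r);
    [exact: (iR_central hB)|exists r'].
have /choice [k2 k2P] : forall r, exists r', iR2 r' = iR1 r.
  by move=> r; have [|r' ->] := tensor_center hB ZB (t := iR1 r);
    [exact: (iR_central hA)|exists r'].
have lk : linear k1.
  by move=> k u v; apply: (iR_inj hA); rewrite k1P [in RHS]linearP /= !k1P linearP.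
have mk : monoid_morphism k1.
  split=> [|u v]; apply: (iR_inj hA); first by rewrite k1P !rmorph1.
  by rewrite (rmorphM iR1) /= !k1P (rmorphM iR2).
have scal (C : algType K) : linear (fun k : K^o => (k : K) *: (1 : C)).
  by move=> k u v; rewrite scalerDl scalerA.
have scam (C : algType K) : monoid_morphism (fun k : K^o => (k : K) *: (1 : C)).
  by split=> [|u v]; rewrite ?scale1r // -scalerAl mul1r scalerA.
pose sc (C : algType K) : {lrmorphism K^o -> C} := mk_lrmorphism (scal C) (scam C).
have [|[FA [FAA FAR]] _] := hA.2 A idfun (sc A \o e0).
  by move=> a r /=; rewrite -scalerAr -scalerAl mul1r mulr1.
(* Since [k1] translates [iR2] into [iR1], this choice of point makes [FB], like [FA], send [iR1 r]
   to the scalar [e0 r]. *)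
have [|[FB [FBB FBR]] _] := hB.2 B idfun (sc B \o (e0 \o mk_lrmorphism lk mk)).
  by move=> a r /=; rewrite -scalerAr -scalerAl mul1r mulr1.
have FAR1 r : FA (iR1 r) = (e0 r : K) *: 1 by rewrite FAR.
have FBR1 r : FB (iR1 r) = (e0 r : K) *: 1.
  rewrite -k2P FBR /=; congr ((e0 _ : K) *: _).
  by apply: (iR_inj hA); rewrite k1P k2P.
have eqA : (FA \o iB : {lrmorphism B -> A}) \o FB =1 FA.
  have comm b r : FA (iB b) * FA (iR2 r) = FA (iR2 r) * FA (iB b).
    by rewrite -!rmorphM (tensorC hB).
  have [_ uniq] := hB.2 A (FA \o iB) (FA \o iR2) comm.
  apply: (uniq ((FA \o iB : {lrmorphism B -> A}) \o FB) FA) => //= [b|r].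
    by rewrite FBB.
  by rewrite -k1P FBR1 FAR1 !linearZ /= !rmorph1.
have eqB : (FB \o iA : {lrmorphism A -> B}) \o FA =1 FB.
  have comm b r : FB (iA b) * FB (iR1 r) = FB (iR1 r) * FB (iA b).
    by rewrite -!rmorphM (tensorC hA).
  have [_ uniq] := hA.2 B (FB \o iA) (FB \o iR1) comm.
  apply: (uniq ((FB \o iA : {lrmorphism A -> B}) \o FA) FB) => //= [b|r].
    by rewrite FAA.
  by rewrite FBR1 FAR1 !linearZ /= !rmorph1.
exists (FB \o iA); exists (FA \o iB).
  by move=> a; have /= := eqA (iA a); rewrite FAA.
by move=> b; have /= := eqB (iB b); rewrite FBB.
Qed.
End TwoFactorizations.

Theorem scalar_center_universally_cancellative (A : algType K) :
  scalar_center A -> universally_cancellative A.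
Proof.
move=> ZA R fgR domR [I [_ [e0 _]]] B T1 T2 iA iR1 iB iR2 hA hB [f bf].
exact: (alg_iso_cofactors (tensor_iso bf hA) hB ZA fgR domR e0).
Qed.
End Cancellation.

(** * Polynomial extensions *)

Section PolynomialExtensions.
Variables (K : fieldType) (d : nat).
Local Notation R := {mpoly K[d]}.

Lemma mpoly_gen (S : R -> Prop) :
  S 1 -> (forall a b, S a -> S b -> S (a + b)) ->
  (forall a b, S a -> S b -> S (a * b)) ->
  (forall (k : K) a, S a -> S (k *: a)) ->
  (forall i, S 'X_i) -> forall r, S r.
Proof.
move=> S1 SD SM SZ SX r; rewrite [r]mpolyE.
apply: big_ind => //; first by rewrite -(scale0r 1); exact: SZ.
move=> m _; apply: SZ; rewrite mpolyXE_id.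
by apply: big_ind => // i _; elim: (m i) => [|k IH] //; rewrite exprS; exact: SM.
Qed.

Lemma mpoly_fin_gen : fin_gen_alg R.
Proof.
exists [seq 'X_i | i : 'I_d] => S S1 SD SM SZ SX; apply: mpoly_gen => // i.
by apply: SX; apply: map_f; rewrite mem_enum.
Qed.

Lemma mpoly_domain : is_domain R.
Proof. by move=> a b /eqP; rewrite mulf_eq0 => /orP [] /eqP; [left|right]. Qed.

(** Evaluation at central elements is multiplicative even if [C] is not commutative. *)
Lemma mpoly_eval (C : algType K) (c : 'I_d -> C) :
  (forall i u, u * c i = c i * u) ->
  exists h : {lrmorphism R -> C}, forall i, h 'X_i = c i.
Proof.
move=> cc; pose h := mmap (in_alg C) c.
have lh : linear h.
  by move=> k u v; rewrite /h mmapD mmapZ /= -scalerAl mul1r.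
have mh : monoid_morphism h.
  have [] := @commr_mmap_is_multiplicative d K C c (in_alg C) cc.
    by move=> p m m' /=; rewrite /GRing.comm -scalerAl -scalerAr mul1r mulr1.
  by split.
by exists (mk_lrmorphism lh mh) => i /=; rewrite /h mmapX mmap1U.
Qed.

Lemma mpoly_K_quotient : has_K_quotient R.
Proof.
have [|h _] := @mpoly_eval K^o (fun=> 0); first by move=> i u; rewrite mulr0 mul0r.
exists (fun r => h r = 0); split; [split; [|split]|].
- exact: rmorph0.
- by move=> a b a0 b0; rewrite rmorphD /= a0 b0 addr0.
- by move=> r a a0; rewrite rmorphM /= a0 mulr0.
exists h; split=> // k; exists (k *: 1).
by rewrite linearZ /= rmorph1 /GRing.scale /= mulr1.
Qed.

Section Extension.
Variables (A P : algType K) (iA : {lrmorphism A -> P}) (t : 'I_d -> P).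
Hypothesis hP : is_poly_ext iA t.

Lemma poly_ext_subalg (S : set P) : subalgebra S ->
  (forall a, S (iA a)) -> (forall j, S (t j)) -> forall u, S u.
Proof.
case: hP => tC [tA univ] hS /(subalg_lift hS) [f fE] St u.
pose c j : subalg hS := Subalg (introT (asboolP _) (St j) : t j \in subalg_pred hS).
have [||[h [hf hc]] _] := univ _ f c.
- by move=> j k; apply: val_inj; rewrite !subalg_valM /= tC.
- by move=> j a; apply: val_inj; rewrite !subalg_valM fE /= tA.
have [_ uniq] := univ _ iA t tC tA.
have E : (subalg_incl hS \o h : {lrmorphism P -> P}) =1 (idfun : {lrmorphism P -> P}).
  by apply: uniq => // [a|r] /=; rewrite ?hf ?hc ?fE.
by rewrite -[u]/(idfun u) -E /=; case: (h u) => s /= /asboolP.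
Qed.

Lemma poly_ext_var_central i u : u * t i = t i * u.
Proof.
have [tC [tA _]] := hP.
apply: (@poly_ext_subalg (fun u => u * t i = t i * u)) => [|a|j //]; last by rewrite tA.
split=> [|a b ha hb|a b ha hb|k a ha].
- by rewrite mul1r mulr1.
- by rewrite mulrDl mulrDr ha hb.
- by rewrite -mulrA hb !mulrA ha.
- by rewrite -scalerAl -scalerAr ha.
Qed.

(** Algebra maps out of the polynomial ring are determined by the images of the variables, which
    turns one universal property into the other. *)
Lemma poly_ext_tensor : exists iR : {lrmorphism R -> P}, is_tensor iA iR.
Proof.
have [tC [tA univ]] := hP.
have [iR iRX] := mpoly_eval poly_ext_var_central.
exists iR; split=> [a r|C f g fg].
  elim/mpoly_gen: r => [|r s hr hs|r s hr hs|k r hr|i].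
  - by rewrite rmorph1 mul1r mulr1.
  - by rewrite rmorphD mulrDl mulrDr /= hr hs.
  - by rewrite rmorphM /= mulrA hr -!mulrA hs.
  - by rewrite linearZ /= -scalerAl -scalerAr hr.
  - by rewrite iRX tA.
have eqR (h : {lrmorphism P -> C}) : (forall j, h (t j) = g 'X_j) ->
    forall r, h (iR r) = g r.
  move=> ht; elim/mpoly_gen => [|r s hr hs|r s hr hs|k r hr|i].
  - by rewrite !rmorph1.
  - by rewrite !rmorphD /= hr hs.
  - by rewrite !rmorphM /= hr hs.
  - by rewrite !linearZ /= hr.
  - by rewrite iRX ht.
have [||[h [hA ht]] uniq] := univ C f (fun j => g 'X_j).
- by move=> j k; rewrite -!rmorphM mulrC.
- by move=> j a; rewrite fg.
split; first by exists h; split=> //; exact: eqR.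
move=> h1 h2 h1A h1R h2A h2R; apply: uniq => // j; rewrite -iRX.
  exact: h1R.
exact: h2R.
Qed.
End Extension.
End PolynomialExtensions.

Lemma universally_strongly_cancellative (K : fieldType) (A : algType K) :
  universally_cancellative A -> strongly_cancellative A.
Proof.
move=> uA d _ B P Q iA t iB s hP hQ PQ.
have [iR1 h1] := poly_ext_tensor hP; have [iR2 h2] := poly_ext_tensor hQ.
exact: (uA _ (@mpoly_fin_gen K d) (@mpoly_domain K d) (@mpoly_K_quotient K d)
           _ _ _ _ _ _ _ h1 h2 PQ).
Qed.

Lemma strongly_cancellative_cancellative (K : fieldType) (A : algType K) :
  strongly_cancellative A -> cancellative A.
Proof. by move=> sA B P Q iA t iB s; apply: sA. Qed.

(** * The center of the quantum Weyl algebra *)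

Section FockSpace.
Variables (K : fieldType) (n : nat) (q : 'I_n -> K) (L : 'M[K]_n).
Hypotheses (hL0 : forall i j, L i j != 0) (hLinv : forall i j, L i j = (L j i)^-1).
Hypothesis hq : forall i (m : nat), (0 < m)%N -> q i ^+ m != 1.

Local Notation multi := {ffun 'I_n -> nat}.
Implicit Types (g m : multi) (i j : 'I_n).

Definition raise i g : multi := [ffun j => (g j + (j == i))%N].
Definition lower i g : multi := [ffun j => (g j - (j == i))%N].

(** The [q_i]-integer [[k]]: [x_i] sends [y_i^k] to [[k] y_i^(k-1)]. *)
Definition qint i (k : nat) : K := \sum_(r < k) q i ^+ r.

(** The scalar picked up when [y_i] moves to its place in the ordered monomial [y^g]. *)
Definition twist i g : K := \prod_(j < n | (j < i)%N) L i j ^+ g j.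

Lemma raiseC i j g : raise i (raise j g) = raise j (raise i g).
Proof. by apply/ffunP => k; rewrite !ffunE addnAC. Qed.
Lemma lowerC i j g : lower i (lower j g) = lower j (lower i g).
Proof. by apply/ffunP => k; rewrite !ffunE subnAC. Qed.
Lemma raiseK i g : lower i (raise i g) = g.
Proof. by apply/ffunP => k; rewrite !ffunE addnK. Qed.
Lemma lowerK i g : (0 < g i)%N -> raise i (lower i g) = g.
Proof.
move=> gi; apply/ffunP => k; rewrite !ffunE subnK //.
by case: eqP => // ->.
Qed.
Lemma raise_lower i j g : i != j -> raise i (lower j g) = lower j (raise i g).
Proof.
move=> ij; apply/ffunP => k; rewrite !ffunE; have [->|kj] := eqVneq k j.
  by rewrite eq_sym (negPf ij) !addn0.
by rewrite !subn0.
Qed.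
Lemma raise_neq i j g : i != j -> raise i g j = g j.
Proof. by rewrite ffunE eq_sym => /negPf ->; rewrite addn0. Qed.
Lemma lower_neq i j g : i != j -> lower i g j = g j.
Proof. by rewrite ffunE eq_sym => /negPf ->; rewrite subn0. Qed.
Lemma raise_eq i g : raise i g i = (g i).+1.
Proof. by rewrite ffunE eqxx addn1. Qed.

Lemma qintS i k : qint i k.+1 = 1 + q i * qint i k.
Proof.
rewrite /qint big_ord_recl expr0 mulr_sumr; congr (_ + _).
by apply: eq_bigr => r _; rewrite exprS.
Qed.

(** [(q_i - 1) [k] = q_i^k - 1], which is nonzero because [q_i] is not a root of unity. *)
Lemma qint_neq0 i k : (0 < k)%N -> qint i k != 0.
Proof.
move=> /(hq i); apply: contra_neq => qk0.
by apply/eqP; rewrite -subr_eq0 subrX1 -/(qint i k) qk0 mulr0.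
Qed.

Lemma twist_neq0 i g : twist i g != 0.
Proof. by apply/prodf_neq0 => j _; apply: expf_neq0. Qed.

Lemma twist_raise_lt i j g : (i < j)%N -> twist j (raise i g) = L j i * twist j g.
Proof.
move=> ij; rewrite /twist (bigD1 i) //= [in RHS](bigD1 i) //= raise_eq exprS -mulrA.
congr (_ * (_ * _)); apply: eq_bigr => k /andP [_ ki].
by rewrite raise_neq // eq_sym.
Qed.
Lemma twist_raise_ge i j g : (j <= i)%N -> twist j (raise i g) = twist j g.
Proof.
move=> ji; apply: eq_bigr => k kj; rewrite raise_neq //.
by apply: contraTneq (leq_trans kj ji) => ->; rewrite ltnn.
Qed.
Lemma twist_lower_lt i j g : (i < j)%N -> (0 < g i)%N ->
  twist j g = L j i * twist j (lower i g).
Proof. by move=> ij gi; rewrite -twist_raise_lt // lowerK. Qed.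
Lemma twist_lower_ge i j g : (j <= i)%N -> twist j (lower i g) = twist j g.
Proof.
move=> ji; apply: eq_bigr => k kj; rewrite lower_neq //.
by apply: contraTneq (leq_trans kj ji) => ->; rewrite ltnn.
Qed.

Local Notation V := (multi -> K^o).
Implicit Type f : V.

(** A vector lists the coefficients of a possibly infinite combination of the [y^g]. [twist i] takes
    the same value at [g] and [lower i g], as it only sees exponents below [i]. *)
Definition yop i f : V := fun g => if (0 < g i)%N then twist i g * f (lower i g) else 0.
Definition xop i f : V := fun g => qint i (g i).+1 * (twist i g)^-1 * f (raise i g).

Lemma yop_linear i : linear (yop i).
Proof.
move=> k u v; apply: funext => g; rewrite /yop !fctE /=; case: ifP => _.
  by rewrite mulrDr /GRing.scale /= mulrCA.
by rewrite scaler0 addr0.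
Qed.
Lemma xop_linear i : linear (xop i).
Proof.
by move=> k u v; apply: funext => g; rewrite /xop !fctE /= mulrDr /GRing.scale /= mulrCA.
Qed.

Definition delta g : V := fun m => (m == g)%:R.

Lemma delta_neq0 g : delta g != 0 :> V.
Proof.
apply/eqP => /(congr1 (fun v : V => v g)); rewrite /delta eqxx => /eqP.
by rewrite oner_eq0.
Qed.

(** The algebra of endomorphisms of Fock space; [y^0] serves as the nonzero vector. *)
Definition fock : algType K := lend (delta_neq0 [ffun=> 0%N]).
Definition yend i : fock := mklin (mk_linear (yop_linear i)).
Definition xend i : fock := mklin (mk_linear (xop_linear i)).

(** On the diagonal this is [[k+1] - q_i [k] = 1]. For [i < j], raising the exponent at [i]
    multiplies [twist j] by [L j i], while [twist i] ignores the exponent at [j]. *)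
Lemma fock_rels : qweyl_rels q L xend yend.
Proof.
split=> [i j ij|i]; last first.
  apply: linP => f; apply: funext => g.
  have -> : (1 : fock) f g = f g by [].
  have -> : (xend i * yend i - q i *: (yend i * xend i)) f g =
     xop i (yop i f) g - (q i : K) * yop i (xop i f) g by [].
  rewrite /xop /yop raise_eq /= twist_raise_ge // raiseK mulrA mulfVK ?twist_neq0 //.
  rewrite qintS; case: ifP => gi.
    rewrite twist_lower_ge // lowerK // [lower i g i]ffunE eqxx subn1 prednK //.
    by field; rewrite twist_neq0.
  have -> : g i = 0%N by apply/eqP; rewrite eqn0Ngt gi.
  by rewrite /qint big_ord0; ring.
have nij : i != j by apply: contraTneq ij => ->; rewrite ltnn.
have nji : j != i by rewrite eq_sym.
have Lij : (L j i)^-1 = L i j by rewrite -hLinv.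
split; apply: linP => f; apply: funext => g.
- rewrite -[LHS]/(xop i (xop j f) g) -[RHS]/(L i j * xop j (xop i f) g).
  rewrite /xop !raise_neq // twist_raise_lt // [twist i (raise j g)]twist_raise_ge 1?ltnW //.
  by rewrite raiseC invfM Lij; ring.
- rewrite -[LHS]/(yop j (yop i f) g) -[RHS]/(L j i * yop i (yop j f) g).
  rewrite /yop !lower_neq //; case: (ltnP 0 (g j)) => gj; case: (ltnP 0 (g i)) => gi.
    2-4: by rewrite ?mulr0.
  by rewrite (twist_lower_lt ij gi) [twist i (lower j g)]twist_lower_ge 1?ltnW // lowerC; ring.
- rewrite -[LHS]/(xop i (yop j f) g) -[RHS]/(L j i * yop j (xop i f) g).
  rewrite /xop /yop raise_neq // lower_neq //; case: (ltnP 0 (g j)) => gj; rewrite ?mulr0 //.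
  by rewrite twist_raise_lt // twist_lower_ge 1?ltnW // raise_lower //; ring.
- rewrite -[LHS]/(xop j (yop i f) g) -[RHS]/(L i j * yop i (xop j f) g).
  rewrite /xop /yop raise_neq // lower_neq //; case: (ltnP 0 (g i)) => gi; rewrite ?mulr0 //.
  rewrite (twist_lower_lt ij gi) twist_raise_ge 1?ltnW // raise_lower // invfM Lij.
  by ring.
Qed.

Lemma yop_delta i g : yop i (delta g) = twist i g *: delta (raise i g).
Proof.
apply: funext => m; rewrite /yop /delta !fctE /= /GRing.scale /=; case: ifP => mi.
  have -> : (lower i m == g) = (m == raise i g).
    by apply/eqP/eqP => [<-|->]; rewrite ?lowerK ?raiseK.
  by case: eqP => [->|]; rewrite ?mulr0 // twist_raise_ge.
by case: eqP => [mE|]; rewrite ?mulr0 //; move: mi; rewrite mE raise_eq.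
Qed.

(** The constant is [[g_i]] divided by [twist i g]; it vanishes for [g i = 0], where the truncated
    [lower i g] does not matter. *)
Lemma xop_delta i g : exists c, (c != 0) = (0 < g i)%N /\
  xop i (delta g) = c *: delta (lower i g).
Proof.
have [gi|gi] := posnP (g i).
  exists 0; rewrite eqxx; split => //; apply: funext => m.
  rewrite /xop /delta scale0r -[RHS]/(0 : K); case: eqP => [gE|]; rewrite ?mulr0 //.
  by move: gi; rewrite -gE raise_eq.
exists (qint i (g i) * (twist i g)^-1); split.
  by rewrite mulf_neq0 ?invr_eq0 ?twist_neq0 ?qint_neq0.
apply: funext => m; rewrite /xop /delta !fctE /= /GRing.scale /=.
have -> : (raise i m == g) = (m == lower i g).
  by apply/eqP/eqP => [<-|->]; rewrite ?lowerK ?raiseK.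
case: eqP => [->|]; rewrite ?mulr0 // twist_lower_ge // [lower i g i]ffunE eqxx.
by rewrite subn1 prednK.
Qed.

(** If [m i > 0], the coefficient of [xop i f] at [lower i m] is a nonzero multiple of [f m]. *)
Lemma xop_kernel f : (forall i, xop i f = 0) -> f = (f [ffun=> 0%N] : K) *: delta [ffun=> 0%N].
Proof.
move=> xf; apply: funext => m; rewrite /delta !fctE /GRing.scale /=.
have [->|m0] := eqVneq m [ffun=> 0%N]; rewrite ?mulr1 ?mulr0 //.
have [i mi] : exists i, (0 < m i)%N.
  apply/existsP; apply: contra_neqT m0 => /existsPn m0.
  by apply/ffunP => i; rewrite ffunE; apply/eqP; rewrite eqn0Ngt.
have := congr1 (fun f : V => f (lower i m)) (xf i); rewrite /xop lowerK // => /eqP.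
rewrite mulf_eq0 => /orP [|/eqP //].
by rewrite mulf_eq0 invr_eq0 (negPf (twist_neq0 _ _)) (negPf (qint_neq0 i (ltn0Sn _))).
Qed.
End FockSpace.

(** * Words in letters that commute up to scalars *)

Section SkewWords.
Variables (K : fieldType) (A : algType K) (I : eqType) (z : I -> A).
Hypothesis skew : forall i j, exists c : K, z i * z j = c *: (z j * z i).

Definition word (w : seq I) : A := \prod_(i <- w) z i.

Lemma word_cons i w : word (i :: w) = z i * word w.
Proof. by rewrite /word big_cons. Qed.

Lemma word_move i u w : exists c : K, word (u ++ i :: w) = c *: word (i :: u ++ w).
Proof.
elim: u => [|j u [c IH]]; first by exists 1; rewrite scale1r.
have [d ji] := skew j i; exists (c * d).
rewrite !cat_cons word_cons IH !word_cons -scalerAr [z j * (z i * _)]mulrA ji.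
by rewrite -scalerAl scalerA -mulrA.
Qed.

Lemma word_perm w w' : perm_eq w w' -> exists c : K, word w = c *: word w'.
Proof.
elim: w' w => [|i w' IH] w pw.
  by exists 1; rewrite scale1r; move/perm_nilP: pw => ->.
have iw : i \in w by rewrite (perm_mem pw) mem_head.
case/splitPr: iw pw => u v; rewrite -[i :: v]cat1s perm_catCA /= perm_cons => pw.
have [c cE] := word_move i u v; have [d dE] := IH _ pw; exists (c * d).
by rewrite cE !word_cons dE -scalerAr scalerA.
Qed.
End SkewWords.

(** * Ordered monomials and the faithful action on Fock space *)

Section QWeylCenter.
Variables (K : fieldType) (n : nat) (q : 'I_n -> K) (L : 'M[K]_n).
Hypotheses (hL0 : forall i j, L i j != 0) (hLinv : forall i j, L i j = (L j i)^-1).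
Hypothesis hq : forall i (m : nat), (0 < m)%N -> q i ^+ m != 1.
Variables (A : algType K) (x y : 'I_n -> A).
Hypothesis hA : is_qweyl q L x y.

Local Notation multi := {ffun 'I_n -> nat}.
Implicit Types (g : multi) (i j : 'I_n).

Lemma qweyl_subalg (S : set A) : subalgebra S ->
  (forall i, S (x i)) -> (forall i, S (y i)) -> forall a, S a.
Proof.
move=> hS Sx Sy a; case: hA => [[rel rel1] univ].
pose X i : subalg hS := Subalg (introT (asboolP _) (Sx i) : x i \in subalg_pred hS).
pose Y i : subalg hS := Subalg (introT (asboolP _) (Sy i) : y i \in subalg_pred hS).
have relS : qweyl_rels q L X Y.
  split=> [i j /rel [r1 r2 r3 r4]|i]; last first.
    by apply: val_inj; rewrite subalg_valB subalg_valZ !subalg_valM rel1.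
  by split; apply: val_inj; rewrite subalg_valZ !subalg_valM.
have [[h hxy] _] := univ _ X Y relS.
have [_ uniq] := univ _ x y hA.1.
have E : (subalg_incl hS \o h : {lrmorphism A -> A}) =1 (idfun : {lrmorphism A -> A}).
  by apply: uniq => // i; rewrite /= (hxy i).1 (hxy i).2.
by rewrite -[a]/(idfun a) -E /=; case: (h a) => s /= /asboolP.
Qed.

Lemma qweyl_skew i j :
  [/\ exists c : K, x i * x j = c *: (x j * x i),
      exists c : K, y i * y j = c *: (y j * y i) &
      exists c k : K, x i * y j = c *: (y j * x i) + k *: 1].
Proof.
have [[rel rel1] _] := hA.
case: (ltngtP i j) => [ij|ji|/val_inj <-].
- have [r1 r2 r3 r4] := rel _ _ ij; split.
  + by exists (L i j).
  + by exists (L j i)^-1; rewrite r2 scalerA mulVf // scale1r.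
  + by exists (L j i), 0; rewrite scale0r addr0.
- have [r1 r2 r3 r4] := rel _ _ ji; split.
  + by exists (L j i)^-1; rewrite r1 scalerA mulVf // scale1r.
  + by exists (L i j).
  + by exists (L j i), 0; rewrite scale0r addr0.
split; [by exists 1; rewrite scale1r|by exists 1; rewrite scale1r|].
by exists (q i), 1; rewrite scale1r -(rel1 i) addrC subrK.
Qed.

Definition canonical_word g : seq 'I_n := flatten [seq nseq (g i) i | i <- enum 'I_n].

Lemma count_canonical_word g j : count_mem j (canonical_word g) = g j.
Proof.
rewrite /canonical_word count_flatten -map_comp sumnE big_map.
rewrite (bigD1_seq j) ?mem_enum ?enum_uniq //= count_nseq /= eqxx mul1n big1 ?addn0 //.
by move=> i ij; rewrite count_nseq /= (negPf ij).
Qed.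

Definition content (w : seq 'I_n) : multi := [ffun j => count_mem j w].

Lemma perm_canonical_word w : perm_eq w (canonical_word (content w)).
Proof. by apply/allP => j _ /=; rewrite count_canonical_word ffunE. Qed.

(** Normal ordering: the [x_i] stand on the right and act first. *)
Definition mon (m : multi * multi) : A :=
  word y (canonical_word m.1) * word x (canonical_word m.2).

Definition mon_span (a : A) : Prop :=
  exists s : seq (K * (multi * multi)), a = \sum_(p <- s) p.1 *: mon p.2.

Lemma mon_spanD a b : mon_span a -> mon_span b -> mon_span (a + b).
Proof. by move=> [s ->] [s' ->]; exists (s ++ s'); rewrite big_cat. Qed.
Lemma mon_spanZ k a : mon_span a -> mon_span (k *: a).
Proof.
move=> [s ->]; exists [seq (k * p.1, p.2) | p <- s].
by rewrite big_map scaler_sumr; apply: eq_bigr => p _; rewrite scalerA.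
Qed.
Lemma mon_span_sum (J : Type) (s : seq J) (F : J -> A) :
  (forall p, mon_span (F p)) -> mon_span (\sum_(p <- s) F p).
Proof.
by move=> sF; apply: big_ind => //; [exists [::]; rewrite big_nil|exact: mon_spanD].
Qed.

Lemma mon_span_word w w' : mon_span (word y w * word x w').
Proof.
have [c ->] := @word_perm _ _ _ y (fun i j => let: And3 _ h _ := qweyl_skew i j in h) _ _
  (perm_canonical_word w).
have [d ->] := @word_perm _ _ _ x (fun i j => let: And3 h _ _ := qweyl_skew i j in h) _ _
  (perm_canonical_word w').
exists [:: (c * d, (content w, content w'))].
by rewrite big_seq1 -scalerAl -scalerAr scalerA.
Qed.

Lemma mon_span_mul (b : A) : (forall w w', mon_span (b * (word y w * word x w'))) ->
  forall a, mon_span a -> mon_span (b * a).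
Proof.
move=> hb _ [s ->]; rewrite mulr_sumr; apply: mon_span_sum => p.
by rewrite -scalerAr; apply: mon_spanZ; apply: hb.
Qed.

Lemma mon_span_y j a : mon_span a -> mon_span (y j * a).
Proof.
by apply: mon_span_mul => w w'; rewrite mulrA -word_cons; exact: mon_span_word.
Qed.

(** [x_i] is pushed to the right through the letters [y_j]; each step leaves a shorter [y]-word. *)
Lemma mon_span_x i a : mon_span a -> mon_span (x i * a).
Proof.
apply: mon_span_mul => w w'; elim: w => [|j w IH].
  rewrite {1}/word big_nil mul1r -word_cons -[word x _]mul1r.
  by have := mon_span_word [::] (i :: w'); rewrite {1}/word big_nil.
have [_ _ [c [k xy]]] := qweyl_skew i j.
rewrite word_cons -mulrA mulrA xy mulrDl -!scalerAl mul1r -mulrA.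
apply: mon_spanD; apply: mon_spanZ; last exact: mon_span_word.
exact: mon_span_y.
Qed.

(** The elements whose left multiplication preserves the span form a subalgebra containing the
    generators; the span contains [1]. *)
Lemma mon_span_all a : mon_span a.
Proof.
suff : forall b, mon_span b -> mon_span (a * b).
  move=> /(_ 1); rewrite mulr1; apply.
  by have := mon_span_word [::] [::]; rewrite /word !big_nil mul1r.
apply: (@qweyl_subalg (fun a => forall b, mon_span b -> mon_span (a * b))).
- split=> [b|u v hu hv b sb|u v hu hv b sb|k u hu b sb].
  + by rewrite mul1r.
  + by rewrite mulrDl; apply: mon_spanD; [exact: hu|exact: hv].
  + by rewrite -mulrA; apply: hu; apply: hv.
  + by rewrite -scalerAl; apply: mon_spanZ; exact: hu.
- by move=> i b; exact: mon_span_x.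
- by move=> i b; exact: mon_span_y.
Qed.

Lemma mon_expansion a : exists (u : seq (multi * multi)) (c : multi * multi -> K),
  uniq u /\ a = \sum_(m <- u) c m *: mon m.
Proof.
have [s ->] := mon_span_all a.
exists (undup (map snd s)), (fun m => \sum_(p <- s | p.2 == m) p.1).
split; first exact: undup_uniq.
under [RHS]eq_bigr do rewrite scaler_suml big_mkcond /=.
rewrite exchange_big /= !big_seq; apply: eq_bigr => p ps.
have pu : p.2 \in undup (map snd s) by rewrite mem_undup map_f.
rewrite (bigD1_seq p.2) ?undup_uniq //= eqxx big1 ?addr0 // => m mp.
by rewrite eq_sym (negPf mp).
Qed.

Variable rho : {lrmorphism A -> fock K n}.
Hypothesis rhoxy : forall i, rho (x i) = xend q L i /\ rho (y i) = yend L i.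
Local Notation act a v := ((rho a : lin _ _) v).

Lemma actM a b v : act (a * b) v = act a (act b v).
Proof. by rewrite rmorphM. Qed.
Lemma actD a b v : act (a + b) v = act a v + act b v.
Proof. by rewrite rmorphD. Qed.
Lemma actZ k a v : act (k *: a) v = k *: act a v.
Proof. by rewrite linearZ. Qed.
Lemma act1 v : act 1 v = v.
Proof. by rewrite rmorph1. Qed.

Lemma act_ywords w g : exists c : K, c != 0 /\
  act (word y w) (delta K g) = c *: delta K [ffun j => (g j + count_mem j w)%N].
Proof.
elim: w => [|i w [c [c0 IH]]].
  exists 1; split; first exact: oner_neq0.
  rewrite /word big_nil act1 scale1r; congr delta.
  by apply/ffunP => j; rewrite ffunE addn0.
set g' := finfun _ in IH; exists (c * twist L i g'); split.
  by rewrite mulf_neq0 // twist_neq0.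
rewrite word_cons actM IH (rhoxy i).2 linearZ /= yop_delta scalerA; congr (_ *: delta _ _).
by apply/ffunP => j; rewrite !ffunE /= eq_sym addnA addnAC.
Qed.

(** Truncated subtraction is harmless: once an exponent runs out, the coefficient is zero. *)
Lemma act_xwords w g : exists c : K, (c != 0) = [forall j, count_mem j w <= g j]%N /\
  act (word x w) (delta K g) = c *: delta K [ffun j => (g j - count_mem j w)%N].
Proof.
elim: w => [|i w [c [c0 IH]]].
  exists 1; rewrite oner_neq0; split; first by apply/esym/forallP.
  rewrite /word big_nil act1 scale1r; congr delta.
  by apply/ffunP => j; rewrite ffunE subn0.
set g' := finfun _ in IH; have [d [d0 dE]] := xop_delta hL0 hq i g'.
exists (c * d); split; last first.
  rewrite word_cons actM IH (rhoxy i).1 linearZ /= dE scalerA; congr (_ *: delta _ _).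
  by apply/ffunP => j; rewrite !ffunE /= [i == j]eq_sym -subnDA addnC.
rewrite mulf_eq0 negb_or c0 d0 ffunE.
apply/andP/forallP => [[/forallP h hi] j|h] /=.
  by case: (eqVneq i j) => [<-|_] /=; [rewrite add1n -subn_gt0|exact: h].
split; first by apply/forallP => j; apply: leq_trans (h j); rewrite /= leq_addl.
by have := h i; rewrite /= eqxx add1n subn_gt0.
Qed.

(** Induction on the degree of the [x]-part. Acting on [y^b], a monomial whose [x]-part has degree
    at least that of [b] survives only if this part equals [b], and then it yields its own [y]-part
    up to a nonzero scalar. *)
Lemma act_faithful a : (forall g, act a (delta K g) = 0) -> a = 0.
Proof.
move=> a0; have [u [c [uu aE]]] := mon_expansion a.
pose deg (g : multi) := (\sum_j g j)%N.
suff c0 (m : multi * multi) : m \in u -> c m = 0.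
  by rewrite aE big_seq big1 // => m /c0 ->; rewrite scale0r.
have [N] := ubnP (deg m.2); elim: N m => // N IH m0 mN m0u.
(* Acting on [y^(m0.2)] and reading the coefficient at [m0.1] isolates [m0]. *)
have := congr1 (fun v : multi -> K^o => v m0.1) (a0 m0.2).
have -> : act a (delta K m0.2) m0.1 = \sum_(m <- u) c m * act (mon m) (delta K m0.2) m0.1.
  rewrite aE; elim: (u) => [|m v IHv]; first by rewrite !big_nil rmorph0.
  by rewrite !big_cons actD actZ -IHv.
have monE (m : multi * multi) : exists d : K, (d != 0) = [forall j, m.2 j <= m0.2 j]%N /\
    act (mon m) (delta K m0.2) = d *: delta K [ffun j => (m0.2 j - m.2 j + m.1 j)%N].
  have [cx [cx0 xE]] := act_xwords (canonical_word m.2) m0.2.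
  rewrite /mon actM xE linearZ.
  have [cy [cy0 yE]] := act_ywords (canonical_word m.1)
     [ffun j => (m0.2 j - count_mem j (canonical_word m.2))%N].
  exists (cx * cy); rewrite mulf_eq0 negb_or cy0 andbT cx0; split.
    by apply: eq_forallb => j; rewrite count_canonical_word.
  rewrite /= yE scalerA; congr (_ *: delta _ _).
  by apply/ffunP => j; rewrite !ffunE !count_canonical_word.
rewrite (bigD1_seq m0) //= big1_seq ?addr0.
  have [d [d0 ->]] := monE m0.
  have -> : [ffun j => (m0.2 j - m0.2 j + m0.1 j)%N] = m0.1.
    by apply/ffunP => j; rewrite ffunE subnn.
  have {}d0 : d != 0 by rewrite d0; apply/forallP.
  rewrite !fctE /delta eqxx /GRing.scale /= mulr1 => /eqP.
  by rewrite mulf_eq0 (negPf d0) orbF => /eqP.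
move=> m /andP [mm0 mu].
have [ltm|lem] := ltnP (deg m.2) (deg m0.2).
  by rewrite IH ?mul0r //; apply: leq_trans ltm _.
have [d [d0 ->]] := monE m; rewrite !fctE /delta /GRing.scale /=.
case: forallP d0 => [le _|_ /negbFE/eqP ->]; last by rewrite mul0r mulr0.
(* A componentwise bound without a drop in total degree is an equality. *)
have m2E : m.2 = m0.2.
  apply/ffunP => j; apply/eqP; rewrite eqn_leq le /= leqNgt; apply: contraL lem => ltj.
  rewrite -ltnNge /deg (bigD1 j) //= [X in (_ < X)%N](bigD1 j) //= -addSn.
  by apply: leq_add => //; apply: leq_sum.
case: eqP => [m1E|]; rewrite ?mulr0 //.
case/eqP: mm0; rewrite [m]surjective_pairing [m0]surjective_pairing m2E m1E.
by congr (_, _); apply/ffunP => j; rewrite ffunE m2E subnn.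
Qed.

Lemma fock_scalar_center : scalar_center A.
Proof.
move=> t ct; set d0 := delta K [ffun=> 0%N] : multi -> K^o.
set g := act t d0; pose k : K := g [ffun=> 0%N].
have gE : g = k *: d0.
  (* [x_i t y^0 = t x_i y^0 = 0]. *)
  apply: (xop_kernel hL0 hq) => i.
  rewrite -[LHS]/((xend q L i : lin _ _) g) -(rhoxy i).1 /g -actM -ct actM (rhoxy i).1.
  have [c [c0 /= ->]] := xop_delta hL0 hq i [ffun=> 0%N].
  by move: c0; rewrite ffunE => /negbFE/eqP ->; rewrite scale0r linear0.
exists k; apply/eqP; rewrite -subr_eq0; apply/eqP; apply: act_faithful => g'.
(* Up to a nonzero scalar, [y^g'] is a word in the [y_i] applied to [y^0]; [t] commutes with that
   word, so it acts by [k] here too. *)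
have [c [c0 cE]] := act_ywords (canonical_word g') [ffun=> 0%N].
have {}cE : delta K g' = c^-1 *: act (word y (canonical_word g')) d0 :> (multi -> K^o).
  rewrite cE scalerA mulVf // scale1r; congr delta.
  by apply/ffunP => j; rewrite !ffunE count_canonical_word.
rewrite -scaleNr actD actZ act1 {1}cE linearZ /= -actM ct actM -/g gE linearZ /=.
by rewrite scalerA [_ * k]mulrC -scalerA -cE scaleNr subrr.
Qed.
End QWeylCenter.

Lemma qweyl_scalar_center (K : fieldType) (n : nat) (q : 'I_n -> K) (L : 'M[K]_n)
    (A : algType K) (x y : 'I_n -> A) :
  (forall i j, L i j != 0) -> (forall i j, L i j = (L j i)^-1) ->
  (forall i (m : nat), (0 < m)%N -> q i ^+ m != 1) ->
  is_qweyl q L x y -> scalar_center A.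
Proof.
move=> hL0 hLinv hq hA.
have [[rho rhoxy] _] := hA.2 _ _ _ (@fock_rels K n q L hL0 hLinv).
exact: (fock_scalar_center hL0 hq hA rhoxy).
Qed.

Theorem theorem1p3 (K : fieldType) (n : nat) (hn : (1 <= n)%N)
    (q : 'I_n -> K) (L : 'M[K]_n)
    (hq0 : forall i, q i != 0)
    (hL0 : forall i j, L i j != 0)
    (hLinv : forall i j, L i j = (L j i)^-1)
    (hLdiag : forall i, L i i = 1)
    (hq : forall i (m : nat), (0 < m)%N -> q i ^+ m != 1)
    (A : algType K) (x y : 'I_n -> A) (hA : is_qweyl q L x y) :
  universally_cancellative A /\ strongly_cancellative A /\ cancellative A.
Proof.
have uA := scalar_center_universally_cancellative (qweyl_scalar_center hL0 hLinv hq hA).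
have sA := universally_strongly_cancellative uA.
by split=> //; split=> //; exact: strongly_cancellative_cancellative.
Qed.
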